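(* Let $A\in\operatorname{GL}_n(\mathbb{R})$ be such that the lattice $L=A\mathbb{Z}^n$ satisfies $d(L)=n$ (equivalently $\nu(L)>0$, equivalently $s_1(L)=\dots=s_n(L)=1$). Then $L$ contains a rectangular sublattice $M$ having a basis of $1$-sparse vectors such that $$[L:M]=\left(\frac{\det(L)}{\nu(L)}\right)^{n-1}.$$ More generally, if $L'\subset\mathbb{R}^n$ is a virtually rectangular lattice and $L$ is a lattice isometric to $L'$ satisfying $d(L)=n$, then there exists a rectangular sublattice $M'$ of $L'$ such that $[L':M']=\left(\det(L)/\nu(L)\right)^{n-1}$.
   Context: $\det(L)=|\det A|$ for $L=A\mathbb{Z}^n$. With rows $\boldsymbol a_1,\dots,\boldsymbol a_n$ of $A$: for nonzero $\boldsymbol x\in\mathbb{R}^n$, $d(\boldsymbol x)=\dim_{\mathbb{Q}}\operatorname{span}_{\mathbb{Q}}\{x_1,\dots,x_n\}$, and $d(L)=\sum_i d(\boldsymbol a_i)$. If $d(\boldsymbol x)=1$, write $\boldsymbol x=\alpha\boldsymbol f$ with $\alpha\in\mathbb{R}$ and $\boldsymbol f\in\mathbb{Z}^n$ with relatively prime coordinates and set $\nu(\boldsymbol x)=|\alpha|$; otherwise $\nu(\boldsymbol x)=0$; $\nu(L)=\prod_i\nu(\boldsymbol a_i)$ (independent of the choice of basis matrix). $\|\boldsymbol x\|_0$ counts nonzero coordinates; a vector is $1$-sparse if $\|\boldsymbol x\|_0\le1$; $s_i(L)$ is the minimal $s$ such that $L$ has $i$ linearly independent vectors with $\|\cdot\|_0\le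 s$. A lattice is rectangular if it has an orthogonal basis, virtually rectangular if it contains a rectangular sublattice of finite index; $L,L'$ are isometric if $L'=UL$ for a real orthogonal matrix $U$. *)

(* Defs.v *)
From HB Require Import structures.
From mathcomp Require Import all_boot all_order all_algebra.
From mathcomp Require Import all_classical reals.

Set Implicit Arguments.
Unset Strict Implicit.
Unset Printing Implicit Defensive.
Import Order.TTheory GRing.Theory Num.Theory.
Local Open Scope ring_scope.
Local Open Scope classical_set_scope.

Section RationalDimension.
Variable R : realType.

Definition qspan k (x : 'rV[R]_k) : set R :=
  [set \sum_j ratr (c 0 j) * x 0 j | c in [set: 'rV[rat]_k]].

Definition qfree k (b : 'rV[R]_k) : Prop :=
  forall c : 'rV[rat]_k, \sum_j ratr (c 0 j) * b 0 j = 0 -> c = 0.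

Definition qdim (V : set R) : nat :=
  xget 0%N [set k | exists b : 'rV[R]_k, qfree b /\ qspan b = V].

Definition dvec n (x : 'rV[R]_n) : nat := qdim (qspan x).

Definition rel_prime n (f : 'rV[int]_n) : bool :=
  \big[gcdn/0%N]_j absz (f 0 j) == 1%N.

(* The scalar a is determined by x up to sign only, so `|a| does not depend on
   the value picked by xget. *)
Definition nuvec n (x : 'rV[R]_n) : R :=
  if dvec x == 1%N then
    `|xget 0 [set a : R | exists f : 'rV[int]_n,
                rel_prime f /\ x = a *: map_mx intr f]|
  else 0.

End RationalDimension.

Section Lattices.
Variables (R : realType) (n : nat).
Implicit Types (A B U : 'M[R]_n) (L M : set 'cV[R]_n).

Definition lattice A : set 'cV[R]_n :=
  [set A *m map_mx intr z | z in [set: 'cV[int]_n]].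

(* All lattices have full rank in R^n; the basis vectors are the columns. *)
Definition is_basis A L : Prop := A \in unitmx /\ L = lattice A.

(* det, d and nu of the lattice A Z^n, as functions of a basis matrix A; the
   values depend only on the lattice. *)
Definition latdet A : R := `|\det A|.
Definition latd A : nat := (\sum_i dvec (row i A))%N.
Definition latnu A : R := \prod_i nuvec (row i A).

Definition norm0 (x : 'cV[R]_n) : nat := #|[pred i | x i 0 != 0]|.

Definition sparse s (x : 'cV[R]_n) : bool := (norm0 x <= s)%N.

Definition has_indep_sparse L i s : Prop :=
  exists V : 'M[R]_(n, i),
    row_free V^T /\ forall j, L (col j V) /\ sparse s (col j V).

Definition smin L i : nat :=
  xget 0%N [set s | has_indep_sparse L i s /\
                    forall t, has_indep_sparse L i t -> (s <= t)%N].

Definition has_sparse_basis s L : Prop :=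
  exists B, is_basis B L /\ forall j, sparse s (col j B).

Definition rectangular L : Prop :=
  exists B, is_basis B L /\
    forall i j, i != j -> (col i B)^T *m col j B = 0.

Definition cosets L M : set (set 'cV[R]_n) :=
  [set [set x + y | y in M] | x in L].

Definition has_index L M k : Prop := (cosets L M #= `I_k)%card.

Definition virtually_rectangular L : Prop :=
  (exists B, is_basis B L) /\
  exists M, [/\ M `<=` L, rectangular M & exists k, has_index L M k].

Definition isometric L L' : Prop :=
  exists U, U^T *m U = 1%:M /\ L' = [set U *m x | x in L].

End Lattices.

(* Main.v *)
Require Import Defs.
From HB Require Import structures.
From mathcomp Require Import all_boot all_order all_algebra.
From mathcomp Require Import all_classical reals.

(* A nonzero row has rational dimension 1 exactly when it is a real multiple of
   a primitive integer vector, so d(L) = n means A = D F with D diagonal and F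
   integral. Then M = A adj(F) Z^n = det(F) D Z^n is spanned by 1-sparse vectors,
   and by the Smith normal form its index in L is |det adj(F)| = |det F|^(n-1),
   where |det F| = det(L)/nu(L). An isometry carries M to a rectangular sublattice
   of L' of the same index. Conversely, n independent 1-sparse vectors of L give
   A Z = V with Z integral and V monomial, and A = V Z^-1 has rows that are
   multiples of rational vectors. *)

Set Implicit Arguments.
Unset Strict Implicit.
Unset Printing Implicit Defensive.
Import Order.TTheory GRing.Theory Num.Theory.
Local Open Scope ring_scope.
Local Open Scope classical_set_scope.

(** * Cosets and the index of a sublattice *)

Lemma card_setT_fin (T : finType) : ([set: T] #= `I_#|T|)%card.
Proof.
rewrite (card_eqr card_II) card_eq_sym.
have <- : enum_rank @` [set: T] = [set: 'I_#|T|].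
  by apply/seteqP; split=> // i _; exists (enum_val i) => //; rewrite enum_valK.
by apply: inj_card_eq => x y _ _ /enum_rank_inj.
Qed.

Section Cosets.
Variables (R : realType) (n : nat).
Implicit Types (A : 'M[R]_n) (L M : set 'cV[R]_n).

Lemma lattice0 A : lattice A 0.
Proof. by exists 0 => //; rewrite map_mx0 mulmx0. Qed.

Lemma latticeB A x y : lattice A x -> lattice A y -> lattice A (x - y).
Proof. by case=> u _ <- [v _ <-]; exists (u - v) => //; rewrite map_mxB mulmxBr. Qed.

(** A lattice is a subgroup, so two cosets agree exactly when their representatives differ by a
    lattice vector; hence [f] induces a bijection from [T] onto the cosets. *)
Lemma has_index_transversal (T : finType) L A (f : T -> 'cV[R]_n) :
    (forall t, L (f t)) ->
    (forall x, L x -> exists t, lattice A (x - f t)) ->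
    (forall s t, lattice A (f s - f t) -> s = t) ->
  has_index L (lattice A) #|T|.
Proof.
move=> Lf f_surj f_inj; pose c x := [set x + y | y in lattice A].
have eq_c x y : lattice A (x - y) -> c x = c y.
  move=> Mxy; apply/seteqP; split=> _ [z Mz <-].
    exists (x - y - (0 - z)); last by rewrite sub0r opprK addrA subrKC.
    by do ![apply: latticeB => //]; exact: lattice0.
  exists (z - (x - y)); first exact: latticeB.
  by rewrite addrCA opprB subrKC addrC.
have c_eq x y : c x = c y -> lattice A (x - y).
  move=> cxy; have: c x x by exists 0; rewrite ?addr0//; exact: lattice0.
  by rewrite cxy => -[z Mz <-]; rewrite addrC addKr.
rewrite /has_index.
have -> : cosets L (lattice A) = (c \o f) @` [set: T].
  apply/seteqP; split=> [_ [x Lx <-]|_ [t _ <-]]; last by exists (f t).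
  by have [t Mxt] := f_surj x Lx; exists t => //=; apply/esym/eq_c.
rewrite -(card_eqr (card_setT_fin T)).
by apply: inj_card_eq => s t _ _ /c_eq/f_inj.
Qed.

End Cosets.

Lemma map_intr_inj (R : realType) m n :
  injective (map_mx intr : 'M[int]_(m, n) -> 'M[R]_(m, n)).
Proof.
move=> X Y /matrixP XY; apply/matrixP=> i j.
by have := XY i j; rewrite !mxE => /intr_inj.
Qed.

(* In the Smith form G = P diag(d) Q, the P t with 0 <= t_i < |d_i| represent the
   cosets of G Z^n, and |det G| is the product of the |d_i|. *)
Lemma has_index_det (R : realType) n (A : 'M[R]_n) (G : 'M[int]_n) :
  A \in unitmx -> \det G != 0 ->
  has_index (lattice A) (lattice (A *m map_mx intr G)) `|\det G|%N.
Proof.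
move=> Au; have [P Pu [Q Qu [d _ ->]]] := int_Smith_normal_form G.
set D := \matrix_(i, j) _.
have abs_det1 (X : 'M[int]_n) : X \in unitmx -> `|\det X|%N = 1%N.
  rewrite unitmxE => /unitrP[y [_ /(congr1 absz)/eqP]].
  by rewrite abszM muln_eq1 => /andP[/eqP].
have DE : D = diag_mx (\row_i d`_i).
  by apply/matrixP=> i j; rewrite !mxE.
have detD : `|\det D|%N = (\prod_(i < n) `|(d`_i)%R|)%N.
  rewrite DE det_diag (big_morph absz abszM (erefl _)).
  by apply: eq_bigr => i _; rewrite mxE.
have DmulE (v : 'cV[int]_n) i : (D *m v) i 0 = d`_i * v i 0.
  by rewrite DE mul_diag_mx !mxE.
rewrite !det_mulmx => det0.
have d_neq0 i : (i < n)%N -> d`_i != 0.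
  move=> lt_in; have: `|\det D|%N != 0%N.
    by rewrite absz_eq0; apply: contraNneq det0 => ->; rewrite mulr0 mul0r.
  rewrite detD -lt0n (bigD1 (Ordinal lt_in)) //= muln_gt0 => /andP[].
  by rewrite absz_gt0.
rewrite !abszM (abs_det1 P)// (abs_det1 Q)// muln1 mul1n detD.
have cardT : #|{dffun forall i : 'I_n, 'I_`|(d`_i)%R|}| = (\prod_(i < n) `|(d`_i)%R|)%N.
  rewrite card_dep_ffun foldrE big_map big_enum /=.
  by apply: eq_bigr => i _; rewrite card_ord.
rewrite -cardT.
pose f (t : {dffun forall i : 'I_n, 'I_`|(d`_i)%R|}) : 'cV[R]_n :=
  A *m map_mx intr (P *m \col_i (t i)%:Z).
apply: (@has_index_transversal _ _ _ _ _ f) => [t||s t].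
- by exists (P *m \col_i (t i)%:Z).
- move=> _ [z _ <-]; have [w wE] : exists w, invmx P *m z = w by eexists.
  (* Divide each coordinate of [w] by [d_i]: the remainders pick the representative, and since
     [z - P r = P D q], the quotients [q] pulled back through [Q] give the vector of the
     sublattice. *)
  pose r (i : 'I_n) := modz (w i 0) d`_i.
  have lt_wd (i : 'I_n) : (`|r i| < `|(d`_i)%R|)%N.
    by rewrite -ltz_nat gez0_abs ?modz_ge0 ?d_neq0// abszE ltz_mod ?d_neq0.
  exists [ffun i => Ordinal (lt_wd i)], (invmx Q *m \col_i divz (w i 0) d`_i) => //.
  rewrite /f -mulmxBr -map_mxB -mulmxA -map_mxM; congr (_ *m map_mx _ _).
  rewrite -mulmxA mulKVmx// -[z](mulKVmx Pu) wE -mulmxBr -mulmxA.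
  congr (_ *m _); apply/colP=> i; rewrite DmulE !mxE ffunE /=.
  rewrite gez0_abs ?modz_ge0 ?d_neq0//.
  by rewrite [X in X - _](divz_eq (w i 0) d`_i) addrK mulrC.
(* Cancelling [A] and [P] leaves [s - t = D Q z], so [s_i] and [t_i] are congruent modulo [d_i], and
   both lie in [[0, |d_i|)]. *)
- case=> z _; rewrite /f -mulmxBr -map_mxB -mulmxA -map_mxM => /(can_inj (mulKmx Au)).
  move=> /map_intr_inj; rewrite -!mulmxA -mulmxBr => /(can_inj (mulKmx Pu)).
  move=> /colP Dz; apply/ffunP=> i; apply/val_inj/eqP => /=.
  have := Dz i; rewrite DmulE !mxE => /eqP; rewrite eq_sym subr_eq => /eqP st.
  have smallE (k : 'I_`|(d`_i)%R|) : modz k d`_i = k.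
    by rewrite -modz_abs modz_small //= abszE ltz_nat ltn_ord.
  by rewrite -eqz_nat -smallE -[X in _ == X]smallE st mulrC modzMDl.
Qed.

(** * Rational dimension of a real vector and primitive integer multiples *)

Section QSpan.
Variable R : realType.

Lemma qspanP k (x : 'rV[R]_k) v :
  qspan x v <-> exists c : 'cV[rat]_k, v = (x *m map_mx ratr c) 0 0.
Proof.
split=> [[c _ <-]|[c ->]].
  by exists c^T; rewrite mxE; apply: eq_bigr => j _; rewrite !mxE mulrC.
by exists c^T => //; rewrite mxE; apply: eq_bigr => j _; rewrite !mxE mulrC.
Qed.

Lemma qspan_mulmx k l (x : 'rV[R]_k) (P : 'M[rat]_(k, l)) :
  qspan (x *m map_mx ratr P) `<=` qspan x.
Proof.
move=> _ /qspanP[c ->]; apply/qspanP; exists (P *m c).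
by rewrite map_mxM mulmxA.
Qed.

Lemma mem_qspan k (x : 'rV[R]_k) j : qspan x (x 0 j).
Proof.
exists (delta_mx 0 j) => //; rewrite (bigD1 j) //= big1 => [|i ne_ij].
  by rewrite mxE !eqxx rmorph1 mul1r addr0.
by rewrite mxE eqxx (negPf ne_ij) rmorph0 mul0r.
Qed.

(** Induction on the number of coordinates: a nontrivial relation with [c_j != 0] expresses [x_j] by
    the other coordinates, so dropping [x_j] keeps the span. This makes the set in [qdim] nonempty,
    so its default value is never taken. *)
Lemma qspan_basis k (x : 'rV[R]_k) :
  exists m (b : 'rV[R]_m), qfree b /\ qspan b = qspan x.
Proof.
elim: k x => [|k IHk] x.
  by exists 0%N, x; split=> // c _; rewrite [c]thinmx0.
have [|/existsNP[c /not_implyP[cx0 /eqP c_neq0]]] := pselect (qfree x).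
  by exists k.+1, x.
have [j cj] : exists j, c 0 j != 0.
  apply/existsP; apply: contraNT c_neq0; rewrite negb_exists => /forallP c0.
  by apply/eqP/rowP=> j; rewrite mxE; apply/eqP/negPn.
have [m [b [b_free bE]]] := IHk (col' j x).
exists m, b; split=> //; rewrite {}bE.
apply/seteqP; split.
  have -> : col' j x = x *m map_mx ratr (col' j 1%:M).
    by rewrite !col'Esub map_mxsub map_mx1 mulmx_colsub mulmx1.
  exact: qspan_mulmx.
(* Column [j] solves the relation [c] for [x_j]; the other columns copy the remaining
   coordinates. *)
pose P := \matrix_(l < k, i < k.+1)
  if i == j then - (c 0 (lift j l) / c 0 j) else (lift j l == i)%:R.
suff {1}-> : x = col' j x *m map_mx ratr P by apply: qspan_mulmx.
apply/rowP=> i; rewrite mxE; case: (unliftP j i) => [l|] ->.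
  rewrite (bigD1 l) //= big1 => [|l' ne_l].
    by rewrite !mxE eq_sym (negPf (neq_lift _ _)) eqxx rmorph1 mulr1 addr0.
  rewrite !mxE eq_sym (negPf (neq_lift _ _)) (inj_eq lift_inj) (negPf ne_l).
  by rewrite rmorph0 mulr0.
have cj' : ratr (c 0 j) != 0 :> R by rewrite fmorph_eq0.
apply: (mulfI cj'); move: cx0; rewrite (bigD1_ord j) //= => /eqP.
rewrite addr_eq0 => /eqP ->; rewrite mulr_sumr -sumrN.
apply: eq_bigr => l _; rewrite !mxE eqxx rmorphN fmorph_div/=.
by rewrite !mulrN mulrCA [ratr (c 0 j) * _]mulrC divfK // mulrC.
Qed.

Lemma dvec_basis n (x : 'rV[R]_n) :
  exists b : 'rV[R]_(dvec x), qfree b /\ qspan b = qspan x.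
Proof.
pose S := [set k | exists b : 'rV[R]_k, qfree b /\ qspan b = qspan x].
exact: (@xgetPex _ 0%N S (qspan_basis x)).
Qed.

Lemma dvec_gt0 n (x : 'rV[R]_n) : x != 0 -> (0 < dvec x)%N.
Proof.
move=> x_neq0; have [b [_]] := dvec_basis x; rewrite lt0n.
move: (dvec x) b => [|//] b bx; case/eqP: x_neq0; apply/rowP=> j.
by have := mem_qspan x j; rewrite -bx => -[c _]; rewrite big_ord0 mxE.
Qed.

(** A one-element basis is the common factor [a]. Conversely, if the span lies in the rational
    multiples of [a], any two of its elements are dependent over the rationals. *)
Lemma dvec1P n (x : 'rV[R]_n) : x != 0 ->
  dvec x = 1%N <-> exists a (c : 'rV[rat]_n), x = a *: map_mx ratr c.
Proof.
move=> x_neq0; have [b [b_free bx]] := dvec_basis x.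
have := dvec_gt0 x_neq0; move: (dvec x) b b_free bx => m b b_free bx m_gt0.
split=> [m1|[a [c xE]]].
  move: b {b_free} bx; rewrite {}m1 => b bx.
  have /fin_all_exists[c cE] j : exists q : rat, x 0 j = b 0 0 * ratr q.
    have := mem_qspan x j; rewrite -bx => -[c _ <-].
    by exists (c 0 0); rewrite big_ord1 mulrC.
  by exists (b 0 0), (\row_j c j); apply/rowP=> j; rewrite !mxE cE.
have /fin_all_exists[q bE] j : exists q : rat, b 0 j = ratr q * a.
  have := mem_qspan b j; rewrite bx => -[d _ <-]; exists (\sum_i d 0 i * c 0 i).
  rewrite rmorph_sum mulr_suml; apply: eq_bigr => i _.
  by rewrite xE !mxE rmorphM/= mulrCA mulrC.
case: m m_gt0 b b_free bx q bE => [//|[//|m]] _ b b_free _ q bE.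
pose i0 : 'I_m.+2 := ord0; pose i1 : 'I_m.+2 := lift ord0 ord0.
have sumE (u v : rat) :
    \sum_j ratr ((u *: delta_mx 0 i0 + v *: delta_mx 0 i1 : 'rV_m.+2) 0 j) * b 0 j
      = (ratr (u * q i0 + v * q i1) * a : R).
  rewrite big_ord_recl big_ord_recl big1 => [|j _].
    rewrite !mxE !bE /= !mulr1 !mulr0 !addr0 add0r.
    by rewrite rmorphD !rmorphM /= mulrDl !mulrA.
  by rewrite !mxE /= !mulr0 addr0 rmorph0 mul0r.
have coef0 u v : u * q i0 + v * q i1 = 0 -> u = 0 /\ v = 0.
  move=> uv0; have := b_free (u *: delta_mx 0 i0 + v *: delta_mx 0 i1).
  rewrite sumE uv0 rmorph0 mul0r => /(_ erefl)/rowP e.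
  have := e i0; have := e i1; rewrite !mxE /= !mulr1 !mulr0 addr0 add0r.
  by move=> -> ->.
(* The relation with coefficients [(q i1, - q i0)] is trivial, which forces [q i0 = 0]; then
   [(1, 0)] is a forbidden relation. *)
have [_ q0] : q i1 = 0 /\ - q i0 = 0.
  by apply: coef0; rewrite mulrC mulNr subrr.
have [] : 1 = 0 :> rat /\ 0 = 0 :> rat.
  by apply: coef0; rewrite mul1r mul0r addr0 -[q i0]opprK q0 oppr0.
by move/eqP; rewrite oner_eq0.
Qed.

(** Clear denominators with their product [N], then divide the integers [g j = N c_j] by their gcd
    [d], which is positive because the vector is nonzero. *)
Lemma primitive_multiple n (a : R) (c : 'rV[rat]_n) : a *: map_mx ratr c != 0 ->
  exists b (f : 'rV[int]_n), rel_prime f /\ a *: map_mx ratr c = b *: map_mx intr f.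
Proof.
move=> x_neq0; pose N := \prod_j denq (c 0 j).
have N_neq0 : N%:~R != 0 :> R.
  by rewrite intr_eq0; apply/prodf_neq0 => j _; rewrite denq_neq0.
pose g j := numq (c 0 j) * \prod_(i | i != j) denq (c 0 i).
have gE j : ratr (c 0 j) = (g j)%:~R / N%:~R :> R.
  apply: (canRL (mulfK N_neq0)); rewrite /g /N (bigD1 j) //= !intrM mulrA.
  by rewrite /ratr divfK // intr_eq0 denq_neq0.
pose d := \big[gcdn/0%N]_j `|g j|%N.
have d_gt0 : (0 < d)%N.
  rewrite lt0n; apply: contraNneq x_neq0 => d0.
  apply/eqP/rowP=> j; rewrite !mxE gE.
  have : (d %| `|g j|)%N by apply: biggcdn_inf.
  by rewrite d0 dvd0n absz_eq0 => /eqP->; rewrite mul0r mulr0.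
have /fin_all_exists[f fE] j : exists q : int, g j = q * d%:Z.
  by apply/dvdzP; rewrite dvdzE; apply: biggcdn_inf.
exists (a * d%:R / N%:~R), (\row_j f j); split; last first.
  apply/rowP=> j; rewrite !mxE gE fE intrM -!mulrA; congr (_ * _).
  by rewrite mulrCA mulrA mulrC [_^-1 * _]mulrC !mulrA mulrAC.
(* Multiplied by [d], the gcd of the [f j] still divides every [g j], hence divides [d]; so it
   divides 1. *)
rewrite /rel_prime -dvdn1 -(@dvdn_pmul2r d) // mul1n.
apply/dvdn_biggcdP => j _; rewrite fE abszM dvdn_pmul2r //.
by apply: biggcdn_inf; rewrite // mxE.
Qed.

Lemma nuvec_primitive n (x : 'rV[R]_n) : x != 0 -> dvec x = 1%N ->
  exists a (f : 'rV[int]_n), nuvec x = `|a| /\ x = a *: map_mx intr f.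
Proof.
move=> x_neq0 d1; have [a [c xE]] := (dvec1P x_neq0).1 d1.
pose S := [set a : R | exists f : 'rV[int]_n, rel_prime f /\ x = a *: map_mx intr f].
have [] : S (xget 0 S).
  by apply: xgetPex; rewrite /S xE; apply: primitive_multiple; rewrite -xE.
by move=> f [_ fE]; exists (xget 0 S), f; rewrite /nuvec d1 eqxx.
Qed.

Lemma nuvec_gt0 n (x : 'rV[R]_n) : x != 0 -> (0 < nuvec x) = (dvec x == 1%N).
Proof.
move=> x_neq0; have [d1|dn1] := eqVneq (dvec x) 1%N; last first.
  by rewrite /nuvec (negPf dn1) ltxx.
have [a [f [-> xE]]] := nuvec_primitive x_neq0 d1; rewrite normr_gt0.
by apply: contraNneq x_neq0 => a0; rewrite xE a0 scale0r.
Qed.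

End QSpan.

(** * Diagonal sublattices and 1-sparse vectors *)

Section SquareLattices.
Variables (R : realType) (n : nat).
Implicit Types A B U : 'M[R]_n.

Lemma row_unitmx_neq0 A i : A \in unitmx -> row i A != 0.
Proof.
move=> Au; apply/eqP => Ai0; have /rowP/(_ i) : delta_mx 0 i = 0 :> 'rV[R]_n.
  by rewrite -[LHS](mulmxK Au) -rowE Ai0 mul0mx.
by rewrite !mxE !eqxx => /eqP; rewrite oner_eq0.
Qed.

(** Rows of an invertible matrix are nonzero, so each of the [n] summands is at least 1; this is the
    equality case of the summed inequality. *)
Lemma latd_eqP A : A \in unitmx ->
  latd A = n <-> forall i, dvec (row i A) = 1%N.
Proof.
move=> Au; have dvec_ge i : true -> (1 <= dvec (row i A) ?= iff (1 == dvec (row i A)))%N.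
  by move=> _; split=> //; apply/dvec_gt0/row_unitmx_neq0.
have := leqif_sum dvec_ge; rewrite sum1_card card_ord -/(latd A) => -[_ latdE].
split=> [An i|d1]; last first.
  by apply/esym/eqP; rewrite latdE; apply/forallP => i; rewrite d1.
by move: latdE; rewrite An eqxx => /esym/forallP/(_ i)/eqP.
Qed.

Lemma latnu_gt0P A : A \in unitmx ->
  0 < latnu A <-> forall i, dvec (row i A) = 1%N.
Proof.
move=> Au; split=> [/lt0r_neq0/prodf_neq0 nu0 i|d1]; last first.
  by apply: prodr_gt0 => i _; rewrite nuvec_gt0 ?row_unitmx_neq0 ?d1.
apply/eqP; apply: contraTT (nu0 i isT) => /negPf dn1.
by rewrite /nuvec dn1 negbK.
Qed.

Lemma latd_factor A : A \in unitmx -> latd A = n ->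
  exists (d : 'rV[R]_n) (F : 'M[int]_n),
    A = diag_mx d *m map_mx intr F /\ latnu A = \prod_i `|d 0 i|.
Proof.
move=> Au /(latd_eqP Au) d1.
have /fin_all_exists[p pE] i : exists p : R * 'rV[int]_n,
    nuvec (row i A) = `|p.1| /\ row i A = p.1 *: map_mx intr p.2.
  by have [a [f []]] := nuvec_primitive (row_unitmx_neq0 i Au) (d1 i); exists (a, f).
exists (\row_i (p i).1), (\matrix_i (p i).2); split.
  apply/row_matrixP=> i; rewrite row_mul row_diag_mx -scalemxAl -rowE mxE (pE i).2.
  by rewrite -map_row rowK.
by apply: eq_bigr => i _; rewrite mxE (pE i).1.
Qed.

(* Writing A = diag(d) F with F integral, G := adj F satisfies
   A G = det F diag(d) and det G = (det F)^(n-1), while |det F| = det L / nu L. *)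
Lemma latd_diagonal_sublattice A : (0 < n)%N -> A \in unitmx -> latd A = n ->
  exists (G : 'M[int]_n) (e : 'rV[R]_n),
    [/\ \det G != 0, A *m map_mx intr G = diag_mx e &
        `|\det G|%N%:R = (latdet A / latnu A) ^+ n.-1].
Proof.
move=> n_gt0 Au An; have [d [F [AE nuE]]] := latd_factor Au An.
have detA : \det A = (\prod_i d 0 i) * (\det F)%:~R.
  by rewrite AE det_mulmx det_diag det_map_mx.
have : \det A != 0 by rewrite -unitfE -unitmxE.
rewrite detA mulf_eq0 negb_or intr_eq0 => /andP[d_neq0 F_neq0].
(* Take determinants in [F adj(F) = det(F) I] and cancel [det F]; [0 < n] gives [n = n.-1 + 1]. *)
have det_adj : \det (\adj F) = \det F ^+ n.-1.
  apply: (mulfI F_neq0); rewrite -det_mulmx mul_mx_adj det_scalar -exprS.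
  by rewrite prednK.
exists (\adj F), ((\det F)%:~R *: d); split.
- by rewrite det_adj expf_neq0.
- rewrite AE -mulmxA -map_mxM mul_mx_adj map_scalar_mx mul_mx_scalar.
  by apply/matrixP => i j; rewrite !mxE mulrnAr.
- rewrite det_adj abszX natrX natr_absz intr_norm /latdet detA nuE normrM.
  by rewrite normr_prod mulrAC divff ?mul1r // -normr_prod normr_eq0.
Qed.

Lemma mul_tr_col_diag A B (e : 'rV[R]_n) : A^T *m B = diag_mx e ->
  forall i j, i != j -> (col i A)^T *m col j B = 0.
Proof.
move=> AB i j /negPf ne_ij; apply/matrixP => u v; rewrite !ord1.
have := congr1 (fun M : 'M_n => M i j) AB; rewrite !mxE ne_ij mulr0n => AB0; rewrite -[RHS]AB0.
by apply: eq_bigr => k _; rewrite !mxE.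
Qed.

Lemma rectangular_lattice B (e : 'rV[R]_n) :
  B \in unitmx -> B^T *m B = diag_mx e -> rectangular (lattice B).
Proof.
by move=> Bu Be; exists B; split; [split|exact: mul_tr_col_diag Be].
Qed.

Lemma sparse_col_diag_mx (e : 'rV[R]_n) j : sparse 1 (col j (diag_mx e)).
Proof.
apply/card_le1_eqP => i k; rewrite !inE !mxE.
have [->|_] := eqVneq i j; last by rewrite eqxx.
by have [->|_] := eqVneq k j; last by rewrite eqxx.
Qed.

Lemma lattice_mulmxl A U : [set U *m x | x in lattice A] = lattice (U *m A).
Proof.
apply/seteqP; split=> [_ [_ [z _ <-] <-]|_ [z _ <-]].
  by exists z => //; rewrite mulmxA.
by exists (A *m map_mx intr z); [exists z|rewrite mulmxA].
Qed.

Lemma lattice_mulmxr A (G : 'M[int]_n) :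
  lattice (A *m map_mx intr G) `<=` lattice A.
Proof. by move=> _ [z _ <-]; exists (G *m z); rewrite // map_mxM mulmxA. Qed.

Lemma has_indep_sparse_gt0 (L : set 'cV[R]_n) i s :
  (0 < i)%N -> has_indep_sparse L i s -> (0 < s)%N.
Proof.
case: i => // i _ [V [/row_freeP[X VX] Vsp]]; rewrite lt0n; apply/eqP => s0.
have := congr1 (fun M : 'M_i.+1 => M 0 0) VX; rewrite !mxE eqxx big1 => [/eqP|k _].
  by rewrite eq_sym oner_eq0.
have [_] := Vsp 0; rewrite s0 /sparse leqn0 => /eqP/card0_eq/(_ k).
by rewrite !inE !mxE => /negbFE/eqP ->; rewrite mul0r.
Qed.

(** The default 0 of [xget] differs from 1, so the value 1 must be attained; conversely 1 is
    minimal, since 0-sparse vectors vanish and cannot be independent. *)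
Lemma smin_eq1P (L : set 'cV[R]_n) i : (0 < i)%N ->
  smin L i = 1%N <-> has_indep_sparse L i 1.
Proof.
move=> i_gt0; split=> [|L1]; rewrite /smin.
  by case: xgetP => // _ -> [+ _] s1; rewrite s1.
apply: xget_unique => [|s [Ls s_min]].
  by split=> // t /(has_indep_sparse_gt0 i_gt0).
by apply/eqP; rewrite eqn_leq s_min // (has_indep_sparse_gt0 i_gt0 Ls).
Qed.

(** The first [i] columns of [B] serve. *)
Lemma has_indep_sparse_basis B s i : B \in unitmx ->
    (forall j, sparse s (col j B)) -> (i <= n)%N ->
  has_indep_sparse (lattice B) i s.
Proof.
move=> Bu Bs le_in; pose f := widen_ord le_in; exists (colsub f B); split.
  apply/row_freeP; exists (invmx B^T *m colsub f 1%:M).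
  rewrite mulmxA trmx_mxsub mul_rowsub_mx mulmxV ?unitmx_tr //.
  rewrite mul_rowsub_mx mul1mx; apply/matrixP => j k; rewrite !mxE.
  by rewrite -!val_eqE.
move=> j; have -> : col j (colsub f B) = col (f j) B by apply/colP=> k; rewrite !mxE.
split=> //; exists (delta_mx (f j) 0) => //.
by rewrite map_delta_mx colE.
Qed.

Lemma has_indep_sparse1_latd A : A \in unitmx ->
  has_indep_sparse (lattice A) n 1 -> latd A = n.
Proof.
move=> Au [V [Vfree Vsp]]; apply/latd_eqP => // i.
have Vu : V \in unitmx by rewrite -unitmx_tr -row_free_unit.
have /fin_all_exists[z zE] j : exists z : 'cV[int]_n, col j V = A *m map_mx intr z.
  by have [[z _ <-] _] := Vsp j; exists z.
(* The integer coordinates are viewed as rationals so that the inverse of [Z] is again rational. *)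
pose Z : 'M[rat]_n := \matrix_(k, j) (z j k 0)%:~R.
have VE : V = A *m map_mx ratr Z.
  apply/matrixP => k j; have /colP/(_ k) := zE j; rewrite !mxE => ->.
  by apply: eq_bigr => l _; rewrite !mxE ratr_int.
have Zu : (map_mx ratr Z : 'M[R]_n) \in unitmx.
  by move: Vu; rewrite VE unitmx_mul => /andP[].
have /fin_all_exists[s Vs] k : exists j, V k j != 0.
  apply/existsP; apply: contraNT (row_unitmx_neq0 k Vu).
  rewrite negb_exists => /forallP V0.
  by apply/eqP/rowP => j; rewrite !mxE; apply/eqP/negPn.
(* Each column of [V] has at most one nonzero entry and each row at least one, so [s] is injective,
   hence a permutation: [V] is monomial. *)
have V_inj j k l : V k j != 0 -> V l j != 0 -> k = l.
  move=> Vk Vl; have [_ /card_le1_eqP] := Vsp j.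
  by apply; rewrite inE mxE.
have [s' sK s'K] : bijective s.
  by apply: injF_bij => k l skl; apply: V_inj (Vs k) _; rewrite skl.
have rowV : row i V = V i (s i) *: delta_mx 0 (s i).
  apply/rowP => j; rewrite !mxE eqxx /=; case: eqVneq => [->|]; first by rewrite mulr1.
  rewrite mulr0 => j_ne; apply/eqP; apply: contraNT j_ne => Vij.
  by rewrite -{1}[j]s'K (V_inj j i (s' j)) // -{2}[j]s'K.
apply/dvec1P; first exact: row_unitmx_neq0.
(* Row [i] of [A = V Z^-1] is [V i (s i)] times row [s i] of [Z^-1]. *)
exists (V i (s i)), (delta_mx 0 (s i) *m invmx Z).
rewrite map_mxM map_invmx map_delta_mx scalemxAl -rowV -row_mul VE.
by rewrite mulmxK.
Qed.

Lemma has_indep_sparse_sub (L M : set 'cV[R]_n) i s :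
  M `<=` L -> has_indep_sparse M i s -> has_indep_sparse L i s.
Proof.
move=> ML [V [Vfree VM]]; exists V; split=> // j.
by have [/ML ? ?] := VM j.
Qed.

End SquareLattices.

Theorem theorem1p3 (R : realType) (n : nat) (n_gt0 : (0 < n)%N)
    (A : 'M[R]_n) (A_unit : A \in unitmx) :
  [/\ latd A = n <-> 0 < latnu A,
      latd A = n <->
        (forall i : nat, (0 < i <= n)%N -> smin (lattice A) i = 1%N),
      latd A = n ->
        exists (M : set 'cV[R]_n) (k : nat),
          [/\ M `<=` lattice A,
              rectangular M,
              has_sparse_basis 1 M,
              has_index (lattice A) M k &
              k%:R = (latdet A / latnu A) ^+ n.-1]
    & latd A = n ->
        forall L' : set 'cV[R]_n,
          virtually_rectangular L' -> isometric (lattice A) L' ->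
          exists (M' : set 'cV[R]_n) (k : nat),
            [/\ M' `<=` L',
                rectangular M',
                has_index L' M' k &
                k%:R = (latdet A / latnu A) ^+ n.-1] ].
Proof.
have AG_unit G : \det G != 0 -> A *m map_mx intr G \in unitmx.
  by move=> G0; rewrite unitmx_mul A_unit unitmxE det_map_mx unitfE intr_eq0.
split=> [||An|An L' _ [U [Uo ->]]].
- by rewrite latd_eqP // latnu_gt0P.
- split=> [An i /andP[i_gt0 le_in]|smin1]; last first.
    (* Only the case [i = n] is used in this direction. *)
    apply: has_indep_sparse1_latd => //; apply/smin_eq1P => //.
    by rewrite smin1 // n_gt0 leqnn.
  have [G [e [G0 AGE _]]] := latd_diagonal_sublattice n_gt0 A_unit An.
  apply/smin_eq1P => //; apply: has_indep_sparse_sub (@lattice_mulmxr _ _ A G) _.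
  apply: has_indep_sparse_basis => //; first exact: AG_unit.
  by move=> j; rewrite AGE; exact: sparse_col_diag_mx.
- have [G [e [G0 AGE detG]]] := latd_diagonal_sublattice n_gt0 A_unit An.
  exists (lattice (A *m map_mx intr G)), `|\det G|%N; split=> //.
  + exact: lattice_mulmxr.
  + apply: (rectangular_lattice (AG_unit _ G0)).
    by rewrite AGE tr_diag_mx mulmx_diag.
  + exists (A *m map_mx intr G); split; first by split=> //; exact: AG_unit.
    by move=> j; rewrite AGE; exact: sparse_col_diag_mx.
  + exact: has_index_det.
- have [G [e [G0 AGE detG]]] := latd_diagonal_sublattice n_gt0 A_unit An.
  have U_unit : U \in unitmx by have /mulmx1_unit[] := Uo.
  rewrite lattice_mulmxl.
  (* The same [G] gives the same index in the rotated lattice, and [U^T U = 1] leaves the diagonal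
     Gram matrix of [A G] unchanged. *)
  exists (lattice (U *m A *m map_mx intr G)), `|\det G|%N; split=> //.
  + exact: lattice_mulmxr.
  + apply: rectangular_lattice; first by rewrite -mulmxA unitmx_mul U_unit AG_unit.
    rewrite -mulmxA trmx_mul -mulmxA (mulmxA U^T) Uo mul1mx AGE tr_diag_mx.
    exact: mulmx_diag.
  + by apply: has_index_det => //; rewrite unitmx_mul U_unit.
Qed.
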